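(* For any real $p\in(0;1)$, the function $S_p$ has no derivative at the points $x=1/3$ and $x=2/3$; that is, $S_p$ is differentiable neither at $1/3$ nor at $2/3$.
   Context: $T_0(x)$ denotes the distance from the real number $x$ to the nearest integer: $T_0(x)=|x-[x+1/2]|=\min_{m\in\mathbb{Z}}|x-m|$. For real $p>0$, $S_p\colon\mathbb{R}\to\mathbb{R}$ is given by $S_p(x)=\sum_{n=0}^{\infty}\left(\frac{T_0(2^n x)}{2^n}\right)^p$ (a convergent series). *)

(* Defs.v *)
From mathcomp Require Import all_boot all_order all_algebra.
From mathcomp Require Import all_classical all_reals all_analysis.
Import Order.TTheory GRing.Theory Num.Theory.
Import numFieldNormedType.Exports.

Set Implicit Arguments.
Unset Strict Implicit.
Unset Printing Implicit Defensive.

Local Open Scope classical_set_scope.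
Local Open Scope ring_scope.

(* |x - [x + 1/2]| is the distance from x to the nearest integer. *)
Definition T0 {R : realType} (x : R) : R :=
  `|x - (Num.floor (x + 1 / 2))%:~R|.

(* For p > 0 the n-th term is at most (2 `^ (- p)) ^+ n, so the series converges
   and limn is its sum; also 0 `^ p = 0, so terms with T0 (2 ^+ n * x) = 0
   vanish. *)
Definition Sp {R : realType} (p : R) (x : R) : R :=
  limn (series (fun n : nat => (T0 (2 ^+ n * x) / 2 ^+ n) `^ p)).

(* Main.v *)
Require Import Defs.
From mathcomp Require Import all_boot all_order all_algebra.
From mathcomp Require Import all_classical all_reals all_analysis.
From mathcomp Require Import ring lra.
Import Order.TTheory GRing.Theory Num.Theory.
Import numFieldNormedType.Exports.

Local Open Scope classical_set_scope.
Local Open Scope ring_scope.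

(* With c = 2^{-p} and symmetry, S_p(1/3 + e) = T_0(1/3 + e)^p + c S_p(1/3 - 2e).
   Along e_n = -(1/3)(-1/2)^n the points 1/3 + e_n run through dyadic rationals
   from 0, and e_n = -2 e_{n+1}.  Bernoulli's inequality bounds
   (1/3 + e_{n+1})^p by its tangent at 1/3, so for the slope d compatible with
   this recursion, f_n = S_p(1/3 + e_n) - S_p(1/3) - d e_n satisfies
   f_{n+1} <= c f_n, with f_0 < 0.  Hence |f_n / e_n| >= 3 |f_0| (2c)^n, which is
   unbounded because 2c > 1, and the difference quotients along e_n diverge. *)

(** Rounding gives [k - 1/2 <= x < k + 1/2], while any other integer differs from [k] by at least 1
    and so lies at distance at least 1/2 from [x]. *)
Lemma T0_le_dist {R : realType} (x : R) (m : int) : T0 x <= `|x - m%:~R|.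
Proof.
rewrite /T0; set k := Num.floor _.
have /andP[kx xk] := floor_itv (x + 1 / 2); rewrite -/k intrD in kx xk.
have [->//|] := eqVneq m k; rewrite neq_lt => /orP[mk|km].
  have : (m + 1)%:~R <= k%:~R :> R by rewrite ler_int lezD1.
  rewrite intrD => h; rewrite (ger0_norm (_ : 0 <= x - m%:~R)); last by lra.
  by rewrite ler_norml; apply/andP; split; lra.
have : (k + 1)%:~R <= m%:~R :> R by rewrite ler_int lezD1.
rewrite intrD => h; rewrite (ler0_norm (_ : x - m%:~R <= 0)); last by lra.
by rewrite ler_norml; apply/andP; split; lra.
Qed.

(** If [k] is the integer nearest to [y], then [m - k] is as far from [m - y] as [k] is from [y].
    Since reflection is an involution, this one inequality yields both. *)
Lemma T0_intB {R : realType} (m : int) (x : R) : T0 (m%:~R - x) = T0 x.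
Proof.
suff le (y : R) : T0 (m%:~R - y) <= T0 y.
  by apply/eqP; rewrite eq_le le -{1}[x](subKr m%:~R) le.
rewrite [leRHS]/T0; set k := Num.floor _.
apply: (le_trans (T0_le_dist _ (m - k))).
by rewrite intrB opprB addrC addrA subrK distrC.
Qed.

Lemma T0_id {R : realType} (x : R) : 0 <= x <= 1 / 2 -> T0 x = x.
Proof.
move=> /andP[x0 x1]; apply/eqP; rewrite eq_le; apply/andP; split.
  by have := T0_le_dist x 0; rewrite subr0 ger0_norm.
rewrite /T0; set k := Num.floor _.
have [k0|k0] := leP k 0.
  have : k%:~R <= 0 :> R by rewrite -[0]/(0%:~R) ler_int.
  by move=> h; rewrite ger0_norm; lra.
have : 1 <= k%:~R :> R by rewrite -[1]/(1%:~R) ler_int -gtz0_ge1.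
by move=> h; rewrite ler0_norm; lra.
Qed.

Lemma T0_ge0 {R : realType} (x : R) : 0 <= T0 x.
Proof. exact: normr_ge0. Qed.

Lemma T0_le1 {R : realType} (x : R) : T0 x <= 1.
Proof.
apply: (le_trans (T0_le_dist x (Num.floor x))).
have /andP[h1 h2] := floor_itv x; rewrite intrD in h2.
by rewrite ler_norml; apply/andP; split; lra.
Qed.

Lemma powR_lt1 {R : realType} (x p : R) : 0 < p -> 0 <= x < 1 -> x `^ p < 1.
Proof.
move=> p0 /andP[x0 x1]; have -> : (1 : R) = 1 `^ p by rewrite powR1.
by apply: gt0_ltr_powR => //; rewrite nnegrE.
Qed.

Section SpTheory.
Context {R : realType} (p : R).
Hypothesis hp0 : 0 < p.
Let c : R := 2^-1 `^ p.

Let c_gt0 : 0 < c. Proof. by rewrite powR_gt0. Qed.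

Let c_lt1 : c < 1. Proof. by apply: powR_lt1 => //; lra. Qed.

Let Sp_term (x : R) (n : nat) : R := (T0 (2 ^+ n * x) / 2 ^+ n) `^ p.

Lemma Sp_termE x n : Sp_term x n = T0 (2 ^+ n * x) `^ p * c ^+ n.
Proof.
rewrite /Sp_term powRM ?T0_ge0 ?invr_ge0 ?exprn_ge0 //; congr (_ * _).
elim: n => [|n IH]; first by rewrite !expr0 invr1 powR1.
rewrite !exprS invfM powRM ?IH ?invr_ge0 ?exprn_ge0 //.
Qed.

Lemma Sp_cvg x : cvgn (series (Sp_term x)).
Proof.
apply: (@series_le_cvg _ _ (geometric 1 c)).
- by move=> n; exact: powR_ge0.
- by move=> n; rewrite /= mul1r exprn_ge0 // ltW.
- move=> n; rewrite Sp_termE /=; apply: ler_wpM2r; first by rewrite exprn_ge0 ?ltW.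
  have -> : (1 : R) = 1 `^ p by rewrite powR1.
  apply: ge0_ler_powR; rewrite ?nnegrE ?T0_ge0 ?T0_le1 //.
  exact: ltW.
- by apply: is_cvg_geometric_series; rewrite ger0_norm ?ltW.
Qed.

(** Doubling the argument shifts the index: term [n.+1] at [x] is [c] times term [n] at [2 * x]. *)
Lemma Sp_rec x : Sp p x = T0 x `^ p + c * Sp p (2 * x).
Proof.
rewrite /Sp; apply: cvg_lim => //; rewrite -cvg_shiftS /=.
have -> : (fun n => series (Sp_term x) n.+1) =
          (fun n => T0 x `^ p + c * series (Sp_term (2 * x)) n).
  apply/funext => n; rewrite /series /= big_nat_recl //=.
  rewrite Sp_termE expr0 !mul1r mulr1 mulr_sumr; congr (_ + _).
  by apply: eq_bigr => i _; rewrite !Sp_termE [2 ^+ _.+1]exprSr -mulrA exprS mulrCA.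
apply: cvgD; first exact: cvg_cst.
by apply: cvgM; [exact: cvg_cst | exact: Sp_cvg].
Qed.

Lemma Sp_1B x : Sp p (1 - x) = Sp p x.
Proof.
rewrite /Sp; congr (limn (series _)); apply/funext => n.
rewrite mulrBr mulr1; have -> : 2 ^+ n = ((2 : int) ^+ n)%:~R :> R by rewrite rmorphXn.
by rewrite T0_intB.
Qed.

End SpTheory.

Lemma bernoulli_powR {R : realType} (p u : R) : 0 < p -> p < 1 -> 0 <= u ->
  u `^ p <= 1 + p * (u - 1).
Proof.
move=> p0 p1 u0.
have q0 : 0 < 1 - p by rewrite subr_gt0.
have := @conjugate_powR R (u `^ p) 1 p^-1 (1 - p)^-1 (powR_ge0 _ _) ler01.
rewrite !invr_gt0 !invrK => /(_ p0 q0); rewrite addrC subrK => /(_ erefl).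
by rewrite -powRrM mulfV ?gt_eqF // powRr1 // powR1 mulr1; lra.
Qed.

Lemma derivable_cvg_slope {R : realType} (f : R -> R) (x : R) (u : R ^nat) :
  derivable f x 1 -> (forall n, u n != 0) -> u @ \oo --> 0 ->
  cvgn (fun n => (f (x + u n) - f x) / u n).
Proof.
move=> /cvg_ex[l /cvgr_dnbhsP fl] u0 cu.
apply/cvg_ex; exists l; have := fl u (conj u0 cu).
apply: cvg_trans; apply: near_eq_cvg; near=> n.
by rewrite /= -[X in X + x]/(_ * _) mulr1 [u n + x]addrC mulrC.
Unshelve. all: by end_near. Qed.

Lemma Sp_slope_divergent {R : realType} (p : R) :
  0 < p -> p < 1 ->
  let e := geometric (- (1 / 3)) (- (1 / 2)) in
  ~ cvgn (fun n => (Sp p (1 / 3 + e n) - Sp p (1 / 3)) / e n).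
Proof.
move=> p0 p1 e.
pose c : R := 2^-1 `^ p; pose s : R := (1 / 3) `^ p.
have s0 : 0 < s by rewrite powR_gt0 //; lra.
have c0 : 0 < c by rewrite powR_gt0.
have c2 : 1 < 2 * c.
  (* Both sides are powers of 1/2, with exponents 1 and [p < 1], and [ln (1/2)] is negative. *)
  have : 2^-1 < c; last by lra.
  rewrite -[ltLHS]powRr1 // /c /powR; case: ifP; first by rewrite invr_eq0 pnatr_eq0.
  move=> _; rewrite ltr_expR.
  have : ln (2^-1 : R) < 0 by apply: ln_lt0; lra.
  nra.
have c1 : c < 1 by apply: powR_lt1 => //; lra.
have eS n : e n = - 2 * e n.+1 by rewrite /e /= exprS; field.
(* This range puts [1 / 3 + e n.+1] in [0, 1/2], where [T0] is the identity. *)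
have e_bound n : - (1 / 3) <= e n.+1 <= 1 / 6.
  elim: n => [|n /andP[h1 h2]]; first by rewrite /e /= expr1; apply/andP; split; lra.
  by have := eS n.+1; move=> ?; apply/andP; split; lra.
have S0 : Sp p (0 : R) = 0.
  have := Sp_rec p p0 (0 : R); rewrite mulr0 T0_id; last by lra.
  by rewrite powR0 ?gt_eqF // add0r -/c; nra.
(* Doubling 1/3 gives 2/3, which the symmetry sends back to 1/3. *)
have S13 : Sp p (1 / 3 : R) = s + c * Sp p (1 / 3).
  rewrite {1}(Sp_rec p p0) T0_id; last by lra.
  by rewrite -(Sp_1B p (1 / 3)) -/c -/s; congr (_ + _ * Sp p _); field.
(* The tangent bound gives [f n.+1 <= c * f n + (3 * p * s - d - 2 * c * d) * e n.+1]; this [d]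
   cancels the last term, whose sign alternates. *)
pose d := 3 * p * s / (1 + 2 * c).
have dE : d * (1 + 2 * c) = 3 * p * s by rewrite /d divfK //; lra.
pose f n := Sp p (1 / 3 + e n) - Sp p (1 / 3) - d * e n.
have f_rec n : f n.+1 <= c * f n.
  have /andP[h1 h2] := e_bound n.
  have -> : f n = Sp p (1 / 3 + e n) - Sp p (1 / 3) - d * e n by [].
  rewrite /f (Sp_rec p p0 (1 / 3 + e n.+1)) T0_id; last by lra.
  have -> : Sp p (2 * (1 / 3 + e n.+1)) = Sp p (1 / 3 + e n).
    by rewrite -Sp_1B (eS n); congr (Sp p _); field.
  have : (1 / 3 + e n.+1) `^ p <= s * (1 + 3 * p * e n.+1).
    have -> : 1 / 3 + e n.+1 = (1 / 3) * (1 + 3 * e n.+1) by field.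
    rewrite powRM; [|lra|lra].
    apply: ler_wpM2l; first exact: ltW.
    apply: le_trans (bernoulli_powR p _ p0 p1 _) _; lra.
  rewrite -/c (eS n).
  have : d * (1 + 2 * c) * e n.+1 = 3 * p * s * e n.+1 by rewrite dE.
  lra.
(* Here [1 / 3 + e 0] is 0, so [f 0] equals [d / 3 - Sp p (1 / 3)]; now [d < 3 * s], and [S13] with
   [0 < c < 1] forces [Sp p (1 / 3) >= s]. *)
have f0 : f 0%N < 0.
  rewrite /f /e /= expr0 mulr1 subrr S0.
  have : d < 3 * s by nra.
  have : s <= Sp p (1 / 3) by nra.
  lra.
have fn n : f n <= c ^+ n * f 0%N.
  elim: n => [|n IH]; first by rewrite expr0 mul1r.
  by rewrite exprS -mulrA; apply: le_trans (f_rec n) _; rewrite ler_pM2l.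
have e_neq0 n : e n != 0.
  by rewrite /e /= mulf_neq0 ?expf_neq0 //; lra.
have norm_e n : `|e n| = 3^-1 * 2^-1 ^+ n.
  by rewrite /e /= normrM normrX !normrN !div1r !gtr0_norm.
move=> cvg_slope.
have : cvgn (fun n => f n / e n).
  have -> : (fun n => f n / e n) =
            (fun n => (Sp p (1 / 3 + e n) - Sp p (1 / 3)) / e n - d).
    by apply/funext => n; rewrite /f mulrBl mulfK.
  by apply: is_cvgB => //; exact: is_cvg_cst.
move=> /cvg_seq_bounded/pinfty_ex_gt0[M M0 /= fM].
have grow n : (2 * c) ^+ n * (3 * - f 0%N) <= M.
  apply: le_trans (fM n I); rewrite normrM normfV norm_e.
  rewrite ler_pdivlMr ?mulr_gt0 ?exprn_gt0 ?invr_gt0 //.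
  have -> : (2 * c) ^+ n * (3 * - f 0%N) * (3^-1 * 2^-1 ^+ n) = - (c ^+ n * f 0%N).
    have h : (2 : R) ^+ n * 2^-1 ^+ n = 1 by rewrite -exprMn mulfV // expr1n.
    transitivity (- (c ^+ n * f 0%N) * (2 ^+ n * 2^-1 ^+ n)); last by rewrite h mulr1.
    by rewrite exprMn; generalize ((2 : R) ^+ n) (2^-1 ^+ n : R) => a b; field.
  have := fn n; have : 0 < c ^+ n by rewrite exprn_gt0.
  by move=> cn h; rewrite ler0_norm; nra.
(* By [grow], this null sequence would stay above the positive constant [3 * - f 0]. *)
have : (fun n => M * (2 * c)^-1 ^+ n) @ \oo --> (0 : R).
  apply: (@cvg_geometric R M); rewrite gtr0_norm ?invr_gt0 ?invf_lt1 //; lra.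
move=> /cvgrPdist_lt /(_ (3 * - f 0%N)) [|N _ /(_ N (leqnn N)) /=]; first by lra.
have cN : 0 < (2 * c) ^+ N by rewrite exprn_gt0 //; lra.
rewrite sub0r normrN exprVn ger0_norm ?divr_ge0 ?(ltW cN) ?(ltW M0) //.
by rewrite ltr_pdivrMr // mulrC ltNge grow.
Qed.

Theorem theorem5 (R : realType) (p : R) (hp0 : 0 < p) (hp1 : p < 1) :
  ~ derivable (Sp p) (1 / 3) 1 /\ ~ derivable (Sp p) (2 / 3) 1.
Proof.
pose e : R ^nat := geometric (- (1 / 3)) (- (1 / 2)).
have e_neq0 n : e n != 0 by rewrite /e /= mulf_neq0 ?expf_neq0 //; lra.
have e0 : e @ \oo --> 0.
  by apply: cvg_geometric; rewrite normrN gtr0_norm; lra.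
split=> dS; apply: (Sp_slope_divergent p hp0 hp1) => /=.
  exact: (derivable_cvg_slope _ _ _ dS e_neq0 e0).
(* The symmetry about 1/2 turns the quotients at 2/3 along [- e] into the negatives of those at 1/3
   along [e]. *)
have ne_neq0 n : - e n != 0 by rewrite oppr_eq0.
have ne0 : - e @ \oo --> 0 by rewrite -[0]oppr0; exact: cvgN.
have sym x : Sp p (2 / 3 - x) = Sp p (1 / 3 + x).
  by rewrite -Sp_1B; congr (Sp p _); field.
have sym0 : Sp p (2 / 3 : R) = Sp p (1 / 3) by rewrite -[2 / 3]subr0 sym addr0.
have -> : (fun n => (Sp p (1 / 3 + e n) - Sp p (1 / 3)) / e n) =
          - (fun n => (Sp p (2 / 3 + (- e) n) - Sp p (2 / 3)) / (- e) n).
  by apply/funext => n; rewrite !fctE sym sym0 invrN mulrN opprK.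
by apply: is_cvgN; exact: (derivable_cvg_slope _ _ _ dS ne_neq0 ne0).
Qed.
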